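(* Let $m=\binom{n+d}{d}$, and let $u$ be a (sufficiently smooth) solution of $\partial_tu=-\mathcal{L}u$ on $\Omega\times[0,T]$ with $\mathcal{L}=\sum_{|\alpha|=0}^np_\alpha(x)\partial^\alpha$. For any given $x\in\Omega$, the parameters $\{p_\alpha(x)\}_{|\alpha|\le n}$ can be recovered from the solution if and only if one can find $m$ instants $t_1,\dots,t_m\in[0,T]$ such that the $m\times m$ matrix $A=(A_{k,\alpha})$, $A_{k,\alpha}:=\partial^\alpha u(x,t_k)$ ($1\le k\le m$, $|\alpha|\le n$), is non-singular.
   Context: $\Omega=\mathbb{T}^d=\mathbb{R}^d/(2\pi\mathbb{Z})^d$; $\alpha$ ranges over $d$-dimensional multi-indices with $|\alpha|\le n$ (there are $m$ of them); $\partial^\alpha$ denotes spatial derivatives; the coefficients $p_\alpha$ are real-valued and do not depend on time. ''Can be recovered'' at $x$ means that $(p_\alpha(x))_{|\alpha|\le n}$ is the unique solution of the linear equations $\sum_{|\alpha|\le n}p_\alpha(x)\partial^\alpha u(x,t)=-\partial_tu(x,t)$, $t\in[0,T]$, given the single trajectory $u$. *)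

(* Defs.v *)
From HB Require Import structures.
From mathcomp Require Import all_boot all_order all_algebra.
From mathcomp Require Import all_classical all_reals all_analysis.

Set Implicit Arguments.
Unset Strict Implicit.
Unset Printing Implicit Defensive.

Import Order.TTheory GRing.Theory Num.Theory.
Import numFieldNormedType.Exports.

Local Open Scope classical_set_scope.
Local Open Scope ring_scope.

(* Multi-indices alpha in N^d with |alpha| <= n; each entry is then < n.+1. *)
Definition mindex (d n : nat) : finType :=
  {a : d.-tuple 'I_n.+1 | (\sum_(i <- a) (i : nat) <= n)%N}.

Lemma card_mindex (d n : nat) : #|mindex d n| = 'C(n + d, d).
Proof.
rewrite card_sig addnC -card_partial_ord_partitions.
by apply: eq_card => a; rewrite !inE.
Qed.

Definition mindex_nth (d n : nat) (j : 'I_('C(n + d, d))) : mindex d n :=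
  enum_val (cast_ord (esym (card_mindex d n)) j).

Lemma mindex_nth_bij (d n : nat) : bijective (@mindex_nth d n).
Proof.
exists (fun a => cast_ord (card_mindex d n) (enum_rank a)) => [j|a].
  by rewrite /mindex_nth enum_valK cast_ordKV.
by rewrite /mindex_nth cast_ordK enum_rankK.
Qed.

Section Derivatives.
Variables (R : realType) (d : nat).

Definition partial (i : 'I_d) (f : 'rV[R]_d -> R) : 'rV[R]_d -> R :=
  fun x => 'D_(delta_mx 0 i) f x.

Definition partials (s : seq 'I_d) (f : 'rV[R]_d -> R) : 'rV[R]_d -> R :=
  foldr partial f s.

Definition mpartial (n : nat) (a : mindex d n) (f : 'rV[R]_d -> R) :
    'rV[R]_d -> R :=
  partials (flatten [seq nseq (tnth (val a) i) i | i <- enum 'I_d]) f.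

(* Functions on the torus R^d / (2 pi Z)^d are represented by their lifts. *)
Definition torus_periodic (f : 'rV[R]_d -> R) : Prop :=
  forall (x : 'rV[R]_d) (k : 'rV[int]_d),
    f (x + (2 * pi) *: map_mx intr k) = f x.

(* The filter is restricted to [0, T], so that the derivative is one-sided at
   the two end points and no value of g outside [0, T] matters. *)
Definition time_quotient (T : R) (g : R -> R) (t : R) : set_system R :=
  (fun s => (g s - g t) / (s - t)) @ within `[0, T] t^'.

Definition time_derivable (T : R) (g : R -> R) (t : R) : Prop :=
  cvg (time_quotient T g t).

Definition time_derive (T : R) (g : R -> R) (t : R) : R :=
  lim (time_quotient T g t).

Definition spacetime (T : R) : set ('rV[R]_d * R) := setT `*` `[0, T].

(* C^n in space and C^1 in time, with derivatives jointly continuous on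
   R^d x [0, T]. *)
Definition smooth_trajectory (n : nat) (T : R) (u : 'rV[R]_d -> R -> R) :
    Prop :=
  [/\ forall (s : seq 'I_d) (i : 'I_d) (x : 'rV[R]_d) (t : R),
        (size s < n)%N -> t \in `[0, T] ->
        derivable (partials s (u^~ t)) x (delta_mx 0 i),
      forall s : seq 'I_d, (size s <= n)%N ->
        {within spacetime T,
          continuous (fun z => partials s (u^~ z.2) z.1)},
      forall (x : 'rV[R]_d) (t : R),
        t \in `[0, T] -> time_derivable T (u x) t
    & {within spacetime T,
        continuous (fun z => time_derive T (u z.1) z.2)}].

Definition applyL (n : nat) (p : mindex d n -> 'rV[R]_d -> R)
    (f : 'rV[R]_d -> R) : 'rV[R]_d -> R :=
  fun x => \sum_(a : mindex d n) p a x * mpartial a f x.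

Definition pde_solution (n : nat) (T : R)
    (p : mindex d n -> 'rV[R]_d -> R) (u : 'rV[R]_d -> R -> R) : Prop :=
  [/\ forall t, t \in `[0, T] -> torus_periodic (u^~ t),
      smooth_trajectory n T u
    & forall (x : 'rV[R]_d) (t : R), t \in `[0, T] ->
        time_derive T (u x) t = - applyL p (u^~ t) x].

Definition identifies (n : nat) (T : R) (u : 'rV[R]_d -> R -> R)
    (x : 'rV[R]_d) (q : mindex d n -> R) : Prop :=
  forall t : R, t \in `[0, T] ->
    \sum_(a : mindex d n) q a * mpartial a (u^~ t) x
      = - time_derive T (u x) t.

Definition recoverable (n : nat) (T : R) (p : mindex d n -> 'rV[R]_d -> R)
    (u : 'rV[R]_d -> R -> R) (x : 'rV[R]_d) : Prop :=
  identifies T u x (fun a => p a x) /\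
  forall q : mindex d n -> R, identifies T u x q -> forall a, q a = p a x.

Definition sample_matrix (n m : nat) (idx : 'I_m -> mindex d n)
    (u : 'rV[R]_d -> R -> R) (x : 'rV[R]_d) (t : 'I_m -> R) : 'M[R]_m :=
  \matrix_(k < m, j < m) mpartial (idx j) (u^~ (t k)) x.

End Derivatives.

(* Main.v *)
Require Import Defs.
From HB Require Import structures.
From mathcomp Require Import all_boot all_order all_algebra.
From mathcomp Require Import all_classical all_reals all_analysis.

Set Implicit Arguments.
Unset Strict Implicit.
Unset Printing Implicit Defensive.

Import Order.TTheory GRing.Theory Num.Theory.
Import numFieldNormedType.Exports.

Local Open Scope classical_set_scope.
Local Open Scope ring_scope.

(** With [x] fixed, the unknowns [p a x] enter the equations linearly: each
    instant [t] gives one equation, whose coefficients form the row of spatial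
    derivatives of [u] at [(x, t)].  The differential equation says that the true
    parameters solve this system, so every other solution differs from them by
    a vector orthogonal to all the rows.  Recovery therefore means that only the
    zero vector is orthogonal to all the rows
    ([recoverable_iff_no_annihilator]).

    The system is infinite, but its rows live in a space of finite dimension
    [m].  Rows can be picked greedily: as long as fewer than [m] independent
    rows have been chosen, some nonzero vector is orthogonal to all of them; it
    is not orthogonal to every row of the system, and a row to which it is not
    orthogonal is independent of the chosen ones ([extend_free_rows]).  After
    [m] rounds the chosen rows form a nonsingular matrix
    ([no_annihilator_iff_unit_sample]).  Conversely, a nonsingular matrix of
    chosen rows already forces a vector orthogonal to them to be zero. *)

Section RowSampling.
Variables (F : fieldType) (I : Type) (S : set I) (m : nat) (v : I -> 'rV[F]_m).

Definition no_annihilator : Prop :=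
  forall c : 'cV[F]_m, (forall t, S t -> v t *m c = 0) -> c = 0.

(** A vector [c] with [A *m c = 0] and [w *m c != 0] certifies that [w] is
    independent of the rows of [A]: multiplying a linear relation by [c]
    isolates the coefficient of [w]. *)
Lemma row_free_col_mx (r : nat) (w : 'rV[F]_m) (A : 'M[F]_(r, m))
    (c : 'cV[F]_m) :
  row_free A -> A *m c = 0 -> w *m c != 0 -> row_free (col_mx w A).
Proof.
move=> freeA Ac0 wc0; apply: inj_row_free => z.
rewrite -[z]hsubmxK mul_row_col => rel.
have a0 : lsubmx z = 0.
  have := congr1 (mulmx^~ c) rel.
  rewrite mulmxDl -!mulmxA Ac0 mulmx0 addr0 mul0mx.
  rewrite [lsubmx z]mx11_scalar mul_scalar_mx => /eqP.
  by rewrite scaler_eq0 (negPf wc0) orbF => /eqP ->; rewrite raddf0.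
move: rel; rewrite a0 mul0mx add0r => rel.
have -> : rsubmx z = 0 by apply: (row_free_inj freeA); rewrite rel mul0mx.
by rewrite row_mx0.
Qed.

(** The vector [c] required by [row_free_col_mx] is a column of the cokernel of
    the rows chosen so far, which is nonzero since their rank is less than
    [m]. *)
Lemma extend_free_rows (r : nat) (A : 'M[F]_(r, m)) :
  no_annihilator -> (r < m)%N -> row_free A ->
  exists2 t, S t & row_free (col_mx (v t) A).
Proof.
move=> noann ltrm freeA.
have coker_neq0 : cokermx A != 0.
  rewrite -mxrank_eq0 mxrank_coker subn_eq0 -ltnNge.
  exact: leq_ltn_trans (rank_leq_row A) ltrm.
have [j cj_neq0] : exists j, col j (cokermx A) != 0.
  apply: contrapT => allcols0; case/eqP: coker_neq0.
  apply/matrixP => i j; rewrite [RHS]mxE.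
  have [/colP/(_ i)|cj] := eqVneq (col j (cokermx A)) 0.
    by rewrite !mxE.
  by case: allcols0; exists j.
apply: contrapT => noext; case/eqP: cj_neq0; apply: noann => t St.
apply: contrapT => /eqP vc_neq0; apply: noext; exists t => //.
apply: row_free_col_mx freeA _ vc_neq0.
by rewrite colE mulmxA mulmx_coker mul0mx.
Qed.

Lemma exists_free_rows (r : nat) :
  no_annihilator -> (r <= m)%N ->
  exists2 t : 'I_r -> I,
    forall k, S (t k) & row_free (\matrix_(k < r) v (t k)).
Proof.
move=> noann; elim: r => [_|r IHr ltrm].
  have t : 'I_0 -> I by case.
  exists t => [[]//|].
  by rewrite /row_free -leqn0 rank_leq_row.
have [t St freet] := IHr (ltnW ltrm).
have [t0 St0 freet0] := extend_free_rows noann ltrm freet.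
pose t' (k : 'I_(1 + r)) := if fintype.split k is inr j then t j else t0.
exists t' => [k|]; first by rewrite /t'; case: fintype.split.
(* The two sides have convertible sizes, [r.+1] and [1 + r]. *)
suff -> : \matrix_(k < r.+1) v (t' k)
    = col_mx (v t0) (\matrix_(k < r) v (t k)) by [].
apply/matrixP => k j; rewrite !mxE /t'.
by case: fintype.split => i; rewrite ?mxE ?ord1.
Qed.

Lemma no_annihilator_iff_unit_sample :
  no_annihilator <->
  exists t : 'I_m -> I,
    (forall k, S (t k)) /\ \matrix_(k < m) v (t k) \in unitmx.
Proof.
split=> [noann|[t [St unitA]] c ann].
  have [t St freet] := exists_free_rows noann (leqnn m).
  by exists t; split=> //; rewrite -row_free_unit.
rewrite -[c](mulKmx unitA).
suff -> : (\matrix_(k < m) v (t k)) *m c = 0 by rewrite mulmx0.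
by apply/row_matrixP => k; rewrite row_mul rowK ann // row0.
Qed.

End RowSampling.

Section Recovery.
Variables (R : realType) (d n : nat) (T : R) (u : 'rV[R]_d -> R -> R).
Variable x : 'rV[R]_d.

Definition derivative_row (t : R) : 'rV[R]_('C(n + d, d)) :=
  \row_j mpartial (mindex_nth j) (u^~ t) x.

Lemma derivative_row_mul (q : mindex d n -> R) (t : R) :
  derivative_row t *m \col_j q (mindex_nth j)
    = (\sum_(a : mindex d n) q a * mpartial a (u^~ t) x)%:M.
Proof.
rewrite [LHS]mx11_scalar mxE; congr (_%:M).
rewrite (reindex _ (onW_bij _ (@mindex_nth_bij d n))).
by apply: eq_bigr => j _; rewrite !mxE mulrC.
Qed.

(** The solutions of the linear system form a translate, by the true
    parameters, of the space orthogonal to all the rows; uniqueness means that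
    this space is zero. *)
Lemma recoverable_iff_no_annihilator (p : mindex d n -> 'rV[R]_d -> R) :
  pde_solution T p u ->
  recoverable T p u x <-> no_annihilator [set` `[0, T]] derivative_row.
Proof.
case=> _ _ pde.
have p_identifies : identifies T u x (fun a => p a x).
  by move=> t tT; rewrite pde // opprK.
split=> [[_ uniq_p] c ann|noann].
  have [g gK Kg] := @mindex_nth_bij d n.
  have c_col : c = \col_j c (g (mindex_nth j)) 0.
    by apply/colP => j; rewrite mxE gK.
  (* Adding an annihilating vector to the parameters gives a solution again. *)
  have shifted : identifies T u x (fun a => p a x + c (g a) 0).
    move=> t tT; rewrite -p_identifies //.
    under eq_bigr do rewrite mulrDl.
    rewrite big_split /= [X in _ + X](_ : _ = 0) ?addr0 //.
    have := ann t tT.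
    rewrite {1}c_col (derivative_row_mul (fun a => c (g a) 0)).
    by move=> /matrixP-/(_ 0 0); rewrite !mxE mulr1n.
  apply/colP => j; rewrite mxE.
  have /eqP := uniq_p _ shifted (mindex_nth j).
  by rewrite gK -subr_eq0 addrAC subrr add0r => /eqP.
split=> // q q_identifies a.
pose c := \col_j (q (mindex_nth j) - p (mindex_nth j) x).
have c0 : c = 0.
  apply: noann => t tT.
  rewrite (derivative_row_mul (fun a => q a - p a x)).
  under eq_bigr do rewrite mulrBl.
  by rewrite sumrB q_identifies // p_identifies // subrr raddf0.
have [g _ Kg] := @mindex_nth_bij d n.
have /colP/(_ (g a)) := c0.
by rewrite !mxE Kg => /eqP; rewrite subr_eq0 => /eqP.
Qed.

End Recovery.

Theorem theorem3p4 (R : realType) (d n : nat) (T : R)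
    (p : mindex d n -> 'rV[R]_d -> R) (u : 'rV[R]_d -> R -> R)
    (d_gt0 : (0 < d)%N) (T_gt0 : 0 < T)
    (p_periodic : forall a : mindex d n, torus_periodic (p a))
    (u_solution : pde_solution T p u) (x : 'rV[R]_d) :
  recoverable T p u x <->
  exists t : 'I_('C(n + d, d)) -> R,
    (forall k, t k \in `[0, T]) /\
    sample_matrix (@mindex_nth d n) u x t \in unitmx.
Proof.
have sample_rows t : sample_matrix (@mindex_nth d n) u x t
    = \matrix_(k < 'C(n + d, d)) derivative_row n u x (t k).
  by apply/matrixP => k j; rewrite !mxE.
apply: (iff_trans (recoverable_iff_no_annihilator x u_solution)).
apply: (iff_trans (no_annihilator_iff_unit_sample _ _)).
by split=> -[t [tT unitA]]; exists t; split=> //; move: unitA;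
  rewrite sample_rows.
Qed.
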